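(* Consider the random walk with multiple function barriers $M[0],\dots,M[N]$ described in the context, started in $M[0]$. Let $y_i$ be the expected number of arrivals in $M[i]$. Let $0\le i<j\le N$, and on the edge between $M[i]$ and $M[j]$ write $n=n[i,j]$, $p=p[i,j]$, $q=q[i,j]$, $\rho=p/q$. For $k=1,2,\dots,n$ let $x_k$ be the expected number of arrivals in state $k$ of this edge. Then, if $\rho\neq 1$, $$x_k=\frac{(1-\rho^k)\frac{p^*_{[j,i]}}{q}\,y_j+(\rho^k-\rho^{n+1})\frac{p^*_{[i,j]}}{p}\,y_i}{1-\rho^{n+1}},$$ and if $\rho=1$, $$x_k=\frac{k\,p^*_{[j,i]}\,y_j+(n+1-k)\,p^*_{[i,j]}\,y_i}{2(n+1)}.$$
   Context: Setting. A finite graph has vertices (multiple function barriers) $M[0],\dots,M[N]$. For $i<j$ the edge between $M[i]$ and $M[j]$ carries a finite number $n[i,j]$ of intermediate states, numbered $1,2,\dots,n[i,j]$ in the direction from $M[i]$ to $M[j]$; on this edge position $0$ is $M[i]$ and position $n[i,j]+1$ is $M[j]$. Each edge has parameters $p=p[i,j]$ (one-step forward probability) and $q=q[i,j]$ (one-step backward probability) with $p+q=1$ and $p[i,j]\,q[i,j]>0$. The discrete-time walk moves as follows. From intermediate state $k$ of an edge it moves to position $k+1$ of that edge with probability $p$ and to position $k-1$ with probability $q$. From a barrier $M[a]$ it moves, with probability $p^*_{[a,b]}$ ($b\ne a$), one step in the direction of $M[b]$ (to position $1$ of the edge if $a<b$, to position $n[b,a]$, the last intermediate state, if $a>b$), and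 with probability $p^*_{[a,a]}$ it is absorbed in $M[a]$. Here $\sum_{b=0}^N p^*_{[a,b]}=1$ for every $a=0,\dots,N$. (Pairs not joined by an edge have $p^*_{[a,b]}=p^*_{[b,a]}=0$.) An absorbed particle makes no further arrivals. The expected number of arrivals in a state $s$ is $\sum_{m=0}^\infty P(\text{the particle is in } s \text{ after } m \text{ steps})$; the time-$0$ presence in the starting state is counted.
   Formalization: For ρ=1 the printed denominator 2(n+1) is wrong by a factor 4 (e.g. N=1, n=1, p=q=1/2, p*_{01}=p*_{11}=1 gives x_1=2, not 1/2); the formula proved is x_k = 2(k p*_{[j,i]} y_j + (n+1-k) p*_{[i,j]} y_i)/(n+1). *)

(* Defs.v *)
From HB Require Import structures.
From mathcomp Require Import all_boot all_order all_algebra.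
From mathcomp Require Import all_classical all_reals all_analysis.

Set Implicit Arguments.
Unset Strict Implicit.
Unset Printing Implicit Defensive.

Import Order.TTheory GRing.Theory Num.Theory.

Local Open Scope classical_set_scope.
Local Open Scope ring_scope.

(* The barriers are M[0], ..., M[N], i.e. the elements of 'I_N.+1. The edge
   data [esize], [fwd], [bwd] are meaningful only at pairs i < j of joined
   barriers, oriented from M[i] to M[j]; their other values are never used. *)
Record barrier_graph (R : realType) (N : nat) := BarrierGraph {
  joined : rel 'I_N.+1;
  esize : 'I_N.+1 -> 'I_N.+1 -> nat;     (* n[i,j]; 0 is allowed *)
  fwd : 'I_N.+1 -> 'I_N.+1 -> R;        (* p[i,j] *)
  bwd : 'I_N.+1 -> 'I_N.+1 -> R;        (* q[i,j] *)
  pstar : 'I_N.+1 -> 'I_N.+1 -> R;      (* p*_[a,b]; absorption if a = b *)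
  joined_sym : symmetric joined;
  joined_irr : irreflexive joined;
  fwd_bwd_sum : forall i j : 'I_N.+1, (i < j)%N -> joined i j ->
    fwd i j + bwd i j = 1;
  fwd_bwd_gt0 : forall i j : 'I_N.+1, (i < j)%N -> joined i j ->
    0 < fwd i j * bwd i j;
  pstar_ge0 : forall a b, 0 <= pstar a b;
  pstar_sum : forall a, \sum_b pstar a b = 1;
  pstar_not_joined : forall a b, a != b -> ~~ joined a b -> pstar a b = 0
}.

Section walk.
Variables (R : realType) (N : nat) (G : barrier_graph R N).

Definition inner_count (i j : 'I_N.+1) : nat :=
  if (i < j)%N && joined G i j then esize G i j else 0%N.

(* Barriers, then intermediate states, then one cemetery state for each barrier
   (the particle absorbed in M[a]), which is distinct from M[a] so that an
   absorbed particle makes no further arrivals. In the intermediate summand,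
   the index l : 'I_(inner_count i j) stands for the state numbered l.+1. *)
Definition state : Type :=
  ('I_N.+1 + {e : 'I_N.+1 * 'I_N.+1 & 'I_(inner_count e.1 e.2)} + 'I_N.+1)%type.

HB.instance Definition _ := Finite.on state.

Definition barrier (a : 'I_N.+1) : state := inl (inl a).

Definition inner (i j : 'I_N.+1) (l : 'I_(inner_count i j)) : state :=
  inl (inr (existT (fun e => 'I_(inner_count e.1 e.2)) (i, j) l)).

Definition absorbed (a : 'I_N.+1) : state := inr a.

(* Position k of the edge from M[i] to M[j]: M[i] for k = 0, the intermediate
   state numbered k for 1 <= k <= n[i,j], and M[j] for k = n[i,j] + 1. *)
Definition pos (i j : 'I_N.+1) (k : nat) : state :=
  if k is l.+1 then
    if insub l is Some l' then @inner i j l' else barrier j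
  else barrier i.

Definition step_towards (a b : 'I_N.+1) : state :=
  if (a < b)%N then pos a b 1 else pos b a (inner_count b a).

Definition trans (s t : state) : R :=
  match s with
  | inl (inl a) =>
      \sum_(b | b != a) pstar G a b * (t == step_towards a b)%:R
      + pstar G a a * (t == absorbed a)%:R
  | inl (inr (existT (i, j) l)) =>
      fwd G i j * (t == pos i j l.+2)%:R + bwd G i j * (t == pos i j l)%:R
  | inr a => (t == absorbed a)%:R
  end.

(* X is a Markov chain with transition probabilities [trans], started at s0. *)
Definition is_walk_from (s0 : state) (d : measure_display)
    (T : measurableType d) (P : probability T R) (X : nat -> T -> state) : Prop :=
  [/\ forall m s, measurable (X m @^-1` [set s]),
      P (X 0%N @^-1` [set s0]) = 1%E
    & forall (m : nat) (h : nat -> state),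
        P [set w | forall l, (l <= m.+1)%N -> X l w = h l] =
        (P [set w | forall l, (l <= m)%N -> X l w = h l]
         * (trans (h m) (h m.+1))%:E)%E].

Definition expected_arrivals (d : measure_display) (T : measurableType d)
    (P : probability T R) (X : nat -> T -> state) (s : state) : \bar R :=
  (\sum_(0 <= m <oo) P (X m @^-1` [set s]))%E.

End walk.

(* Main.v *)
(* Conditioning on the last step, the expected numbers of arrivals satisfy
   x_k = p x_(k-1) + q x_(k+1) on the edge, where x_0 and x_(n+1) stand for
   p*_[i,j] y_i / p and p*_[j,i] y_j / q, so x_k is the harmonic interpolation of
   these two boundary values. All of this happens in [0, +oo]: if the boundary
   values are finite, the partial sums over time are subharmonic, hence bounded
   by the interpolation, so every x_k is finite and uniqueness for the harmonic
   recurrence applies; an infinite boundary value makes every x_k infinite. *)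
Require Import Defs.
From HB Require Import structures.
From mathcomp Require Import all_boot all_order all_algebra.
From mathcomp Require Import all_classical all_reals all_analysis.
From mathcomp Require Import ring lra.

Set Implicit Arguments.
Unset Strict Implicit.
Unset Printing Implicit Defensive.

Import Order.TTheory GRing.Theory Num.Theory.

Local Open Scope classical_set_scope.
Local Open Scope ring_scope.

(** * Harmonic functions on a segment and sums over time *)

Section ruin.
Variables (R : realType) (p q : R) (n : nat).
Hypotheses (p_gt0 : 0 < p) (q_gt0 : 0 < q) (pDq : p + q = 1).

(* A superharmonic function that has become negative keeps decreasing, so it
   could not be nonnegative at n + 1. *)
Lemma superharmonic_ge0 (f : nat -> R) :
  0 <= f 0%N -> 0 <= f n.+1 ->
  (forall k, (k < n)%N -> p * f k + q * f k.+2 <= f k.+1) ->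
  forall k, (k <= n.+1)%N -> 0 <= f k.
Proof.
move=> f0 fn fsup.
have decr k : (k <= n)%N -> f k < 0 -> f k.+1 < f k.
  elim: k => [_|k IH kn fk]; first by rewrite ltNge f0.
  have fk1 : f k.+1 < f k.
    have [fk0|fk0] := ltP (f k) 0; last exact: lt_le_trans fk fk0.
    exact: IH (ltnW kn) fk0.
  rewrite -subr_lt0 -(pmulr_rlt0 _ q_gt0).
  have : p * (f k.+1 - f k) < 0 by rewrite pmulr_rlt0// subr_lt0.
  have : (p + q) * f k.+1 = f k.+1 by rewrite pDq mul1r.
  by have := fsup k kn; lra.
move=> k kn; rewrite leNgt; apply/negP => fk.
suff: f n.+1 < 0 by rewrite ltNge fn.
rewrite -(subnKC kn); have : (k + (n.+1 - k) <= n.+1)%N by rewrite subnKC.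
elim: (n.+1 - k)%N => [|l IH] ll; first by rewrite addn0.
move: ll; rewrite addnS => ll.
have fkl := IH (ltnW ll).
exact: lt_trans (decr _ ll fkl) fkl.
Qed.

(** The minimum principle applies both to [f] and to its negative. *)
Lemma harmonic_eq0 (f : nat -> R) :
  f 0%N = 0 -> f n.+1 = 0 ->
  (forall k, (k < n)%N -> f k.+1 = p * f k + q * f k.+2) ->
  forall k, (k <= n.+1)%N -> f k = 0.
Proof.
move=> f0 fn fE k kn; apply/eqP; rewrite eq_le; apply/andP; split; last first.
  by apply: superharmonic_ge0 kn => [||l ln]; rewrite ?f0 ?fn -?fE.
rewrite -oppr_ge0.
by apply: (@superharmonic_ge0 (fun l => - f l)) kn => [||l ln];
  rewrite ?f0 ?fn ?oppr0// !mulrN -opprD -fE.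
Qed.

(* The probability that the walk started in k hits n + 1 before 0, with the
   roles of p and q exchanged: arrivals propagate along the reversed walk. The
   geometric sums treat p = q and p != q together. *)
Definition ruin (k : nat) : R :=
  (\sum_(l < k) (p / q) ^+ l) / (\sum_(l < n.+1) (p / q) ^+ l).

Lemma geometric_gt0 k : 0 < \sum_(l < k.+1) (p / q) ^+ l.
Proof.
rewrite big_ord_recl expr0 ltr_pwDl// sumr_ge0// => l _.
by rewrite exprn_ge0// divr_ge0// ltW.
Qed.

Lemma ruin0 : ruin 0 = 0. Proof. by rewrite /ruin big_ord0 mul0r. Qed.

Lemma ruinS : ruin n.+1 = 1.
Proof. by rewrite /ruin divff// gt_eqF// geometric_gt0. Qed.

(** The top term of the longest sum, weighted by q, is q (p/q)^(k+1) = p (p/q)^k; together with q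
    (p/q)^k it gives (p/q)^k exactly once, since p + q = 1. *)
Lemma ruin_harmonic k : ruin k.+1 = p * ruin k + q * ruin k.+2.
Proof.
rewrite /ruin !mulrA -mulrDl; congr (_ / _).
rewrite !big_ord_recr/= exprS; set s := \sum_(_ < _) _; set r := _ ^+ k.
have qu : q != 0 by rewrite gt_eqF.
have -> : q * (s + r + p / q * r) = q * s + (p + q) * r by field.
by rewrite addrA -mulrDl pDq !mul1r.
Qed.

Lemma ruin_gt0 k : 0 < ruin k.+1.
Proof. by rewrite divr_gt0// geometric_gt0. Qed.

Lemma ruin_lt1 k : (k <= n)%N -> ruin k < 1.
Proof.
move=> kn; rewrite ltr_pdivrMr ?geometric_gt0// mul1r.
rewrite -!(big_mkord xpredT (fun l => (p / q) ^+ l)).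
rewrite (big_cat_nat (leq0n k) (leqW kn))//= ltrDl.
rewrite big_nat_recl// ltr_pwDl ?exprn_gt0 ?divr_gt0// sumr_ge0// => l _.
by rewrite exprn_ge0// divr_ge0// ltW.
Qed.

(** [W m k] stands for the probability of being at position k at time m, rescaled at the two ends.
    No evolution is imposed at 0 and n + 1, which act as arbitrary nonnegative sources. *)
Variable W : nat -> nat -> R.
Hypotheses (W_ge0 : forall m k, 0 <= W m k)
  (W0 : forall k, (k < n)%N -> W 0%N k.+1 = 0)
  (WS : forall m k, (k < n)%N -> W m.+1 k.+1 = p * W m k + q * W m k.+2).

Let total k : \bar R := (\sum_(0 <= m <oo) (W m k)%:E)%E.

Let total_ge0 k : (0 <= total k)%E.
Proof. by apply: nneseries_ge0 => m _ _; rewrite lee_fin. Qed.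

(** The recurrence is summed over time; the shift by one time step loses nothing because the time-0
    term vanishes. *)
Let total_harmonic k : (k < n)%N ->
  total k.+1 = (p%:E * total k + q%:E * total k.+2)%E.
Proof.
move=> kn; rewrite /total nneseries_recl//=; last by move=> m _; rewrite lee_fin.
rewrite W0// add0e.
rewrite -(@nneseries_addn _ _ 1); last by move=> m; rewrite lee_fin.
rewrite -nneseriesZl; last by move=> m _; rewrite lee_fin.
rewrite -nneseriesZl; last by move=> m _; rewrite lee_fin.
rewrite -nneseriesD; [|by move=> m _ _; rewrite -EFinM lee_fin mulr_ge0// ltW..].
by apply: eq_eseriesr => m _; rewrite addn1 WS.
Qed.

Lemma total_fin_num k : total 0 \is a fin_num -> total n.+1 \is a fin_num ->
  (k <= n.+1)%N -> total k \is a fin_num.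
Proof.
move=> fin0 finn kn.
pose B l := (1 - ruin l) * fine (total 0) + ruin l * fine (total n.+1).
rewrite ge0_fin_numE//; apply: le_lt_trans (ltry (B k)).
apply: lime_le.
  by apply: is_cvg_nneseries => m _ _; rewrite lee_fin.
apply: nearW => M; rewrite sumEFin lee_fin -subr_ge0.
pose S M l := \sum_(0 <= m < M) W m l.
have Sle l : total l \is a fin_num -> S M l <= fine (total l).
  move=> lfin; rewrite -lee_fin fineK// /S -sumEFin.
  by apply: nneseries_lim_ge => m _; rewrite lee_fin.
apply: (@superharmonic_ge0 (fun l => B l - S M l)) kn.
- by rewrite /B ruin0 subr0 mul1r mul0r addr0 subr_ge0 Sle.
- by rewrite /B ruinS subrr mul1r mul0r add0r subr_ge0 Sle.
- move=> l ln.
  have -> : B l.+1 = p * B l + q * B l.+2.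
    rewrite /B ruin_harmonic; set a := fine (total 0); set b := fine _.
    transitivity ((p + q - (p * ruin l + q * ruin l.+2)) * a +
      (p * ruin l + q * ruin l.+2) * b); first by rewrite pDq.
    ring.
  (* The time-0 term is zero inside the edge, so the right-hand side is the partial sum with one
     more nonnegative term. *)
  have : S M l.+1 <= p * S M l + q * S M l.+2.
    rewrite (_ : _ + _ = S M.+1 l.+1).
      by rewrite [leRHS]big_nat_recr//= lerDl.
    rewrite [RHS]big_nat_recl//= W0// add0r !mulr_sumr -big_split.
    by apply: eq_bigr => m _; rewrite WS.
  lra.
Qed.

Lemma sum_edge k : (k <= n.+1)%N ->
  total k = ((1 - ruin k)%:E * total 0 + (ruin k)%:E * total n.+1)%E.
Proof.
(* At either end one weight is 0, and the convention 0 * +oo = 0 keeps the formula true when the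
   opposite end is infinite. *)
case: k => [|k] kn; first by rewrite ruin0 subr0 mul1e mul0e adde0.
move: kn; rewrite ltnS leq_eqVlt => /predU1P[->|kn].
  by rewrite ruinS subrr mul1e mul0e add0e.
have r1 : 0 < 1 - ruin k.+1 by rewrite subr_gt0 ruin_lt1.
have r0 := ruin_gt0 k.
have gt0oo (r : R) : 0 < r -> (r%:E * +oo = +oo)%E.
  by move=> r_gt0; rewrite gt0_muley// lte_fin.
have noNy (r : R) l : 0 < r -> (r%:E * total l != -oo)%E.
  move=> r_gt0; rewrite gt_eqF// (lt_le_trans (ltNyr 0))//.
  by rewrite mule_ge0// lee_fin ltW.
have [fin0|] := boolP (total 0 \is a fin_num); last first.
  rewrite ge0_fin_numE// -leNgt leye_eq => /eqP t0.
  rewrite t0 gt0oo// addye ?noNy//.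
  (* An infinite left end spreads rightwards through the term weighted by p. *)
  elim: k kn {r0 r1} => [|k IH] kn; rewrite total_harmonic//.
    by rewrite t0 gt0oo// addye ?noNy.
  by rewrite IH ?(ltnW kn)// gt0oo// addye ?noNy.
have [finn|] := boolP (total n.+1 \is a fin_num); last first.
  rewrite ge0_fin_numE// -leNgt leye_eq => /eqP tn.
  rewrite tn gt0oo// addey ?noNy//.
  (* An infinite right end spreads leftwards, so the induction runs on the distance l to n + 1. *)
  suff tl l : (l <= n)%N -> total (n.+1 - l) = +oo%E.
    have := tl _ (leq_subr k n); rewrite subSn ?leq_subr// subKn ?(ltnW kn)//.
  elim: l => [|l IH] ln; first by rewrite subn0.
  rewrite subSS -(subnSK ln) total_harmonic; last by rewrite subnSK// leq_subr.
  rewrite subnSK// -subSn ?(ltnW ln)// IH ?(ltnW ln)//.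
  by rewrite gt0oo// addey ?noNy.
have fin l := @total_fin_num l fin0 finn.
pose B l := (1 - ruin l) * fine (total 0) + ruin l * fine (total n.+1).
have : fine (total k.+1) - B k.+1 = 0.
  apply: (@harmonic_eq0 (fun l => fine (total l) - B l)) (leqW kn).
  - by rewrite /B ruin0 subr0 mul1r mul0r addr0 subrr.
  - by rewrite /B ruinS subrr mul1r mul0r add0r subrr.
  - move=> l ln.
    have -> : fine (total l.+1) = p * fine (total l) + q * fine (total l.+2).
      have fl : total l \is a fin_num by apply: fin; rewrite ltnW// ltnW.
      have fl2 : total l.+2 \is a fin_num by apply: fin.
      rewrite total_harmonic// fineD; [|exact: fin_numM..].
      by rewrite fineM// fineM.
    have -> : B l.+1 = p * B l + q * B l.+2.
      rewrite /B ruin_harmonic; set a := fine (total 0); set b := fine _.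
      transitivity ((p + q - (p * ruin l + q * ruin l.+2)) * a +
        (p * ruin l + q * ruin l.+2) * b); first by rewrite pDq.
      ring.
    ring.
move=> /eqP; rewrite subr_eq0 => /eqP e.
by rewrite -[LHS]fineK ?fin ?(leqW kn)// e /B EFinD !EFinM !fineK.
Qed.
End ruin.

(** * One-step transitions into an intermediate state *)

Local Arguments pos : simpl never.

Section edge.
Variables (R : realType) (N : nat) (G : barrier_graph R N).

Lemma pos_eq_inner a b m i j (l : 'I_(inner_count G i j)) :
  (pos G a b m == inner l) = [&& a == i, b == j & m == l.+1].
Proof.
case: m => [|m]; first by rewrite !andbF.
rewrite /pos; case: insubP => [l' _ <-|ml].
  apply/eqP/and3P => [e|[/eqP ai /eqP bj]].
    (* Reading the index off as a plain number avoids comparing ordinals whose types depend on the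
       edge. *)
    pose f (s : state G) := if s is inl (inr u)
      then Some ((projT1 u).1, (projT1 u).2, nat_of_ord (projT2 u)) else None.
    have [ai bj ml] : f (inner l') = f (inner l) by rewrite e.
    by split; apply/eqP => //; congr _.+1.
  subst a b; rewrite eqSS => /eqP/val_inj ->//.
apply/esym/negbTE/and3P => -[/eqP ai /eqP bj]; subst a b.
by rewrite eqSS => /eqP e; rewrite e ltn_ord in ml.
Qed.

Lemma barrier_eq_pos a i j m : (0 < m <= inner_count G i j)%N ->
  (barrier G a == pos G i j m) = false.
Proof. by case: m => // m /= mn; rewrite /pos insubT. Qed.

(** The guards separate the neighbours that are barriers, which send mass with [pstar], from those
    inside the edge. If n = 1, both neighbours are barriers. *)
Lemma trans_pos (i j : 'I_N.+1) k s : (i < j)%N -> joined G i j ->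
  (0 < k <= esize G i j)%N ->
  trans s (pos G i j k) =
    (k == 1%N)%:R * (pstar G i j * (s == barrier G i)%:R)
    + (1 < k)%N%:R * (fwd G i j * (s == pos G i j k.-1)%:R)
    + ((k == esize G i j)%:R * (pstar G j i * (s == barrier G j)%:R)
      + (k < esize G i j)%N%:R * (bwd G i j * (s == pos G i j k.+1)%:R)).
Proof.
move=> ltij ij; case: k => // k /andP[_ kn].
have nE : inner_count G i j = esize G i j by rewrite /inner_count ltij ij.
have ij' : (i == j) = false := ltn_eqF ltij.
have ji' : (j == i) = false := gtn_eqF ltij.
have kn' : (k < inner_count G i j)%N by rewrite nE.
have posk : pos G i j k.+1 = inner (Ordinal kn').
  by rewrite /pos insubT.
rewrite posk; case: s => [[a|[[a b] l]]|a].
- rewrite [trans _ _]/= mulr0 addr0.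
  (* The position is now k + 1: a barrier step reaches it only from M[i] when it is the first one,
     or from M[j] when it is the last. *)
  have stepE b : (inner (Ordinal kn') == step_towards G a b) =
      (a == i) && (b == j) && (k == 0%N)
      || (a == j) && (b == i) && (k.+1 == esize G i j).
    rewrite eq_sym /step_towards; case: ltnP => ab; rewrite pos_eq_inner/=.
      rewrite eqSS [0%N == k]eq_sym andbA; case: (a =P j) => [aj|_]; last first.
        by rewrite orbF.
      case: (b =P i) => [bi|_]; last by rewrite orbF.
      by move: ab; rewrite aj bi ltnNge ltnW.
    case: (a =P i) => [ai|_]; [case: (b =P j) => [bj|_]|] => /=.
    + by move: ab; rewrite ai bj leqNgt ltij.
    + by rewrite ai ij' andbF.
    + rewrite andbCA -andbA; case: (a =P j) => //= ->.
      by case: (b =P i) => //= ->; rewrite nE eq_sym.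
  under eq_bigr do rewrite stepE.
  (* The guard removes k = 0, where [pos G i j k] is itself the barrier M[i]. *)
  have -> : (1 < k.+1)%N%:R * (fwd G i j * (barrier G a == pos G i j k)%:R) = 0 :> R.
    rewrite ltnS; case: posnP => [_|k0]; first by rewrite mul0r.
    by rewrite barrier_eq_pos ?k0 1?ltnW// !mulr0.
  have -> : (k.+1 < esize G i j)%N%:R *
      (bwd G i j * (barrier G a == pos G i j k.+2)%:R) = 0 :> R.
    case: ltnP => [k1|_]; last by rewrite mul0r.
    by rewrite barrier_eq_pos ?nE// !mulr0.
  rewrite !addr0 -[barrier G a == barrier G i]/(a == i).
  rewrite -[barrier G a == barrier G j]/(a == j).
  have [->|ai] := eqVneq a i.
    rewrite ij' !mulr0 addr0 (bigD1 j) ?ji'// big1 => [|b].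
      by rewrite !eqxx/= orbF addr0 mulr1 mulrC.
    by move=> /andP[_ /negbTE ->]; rewrite andbF mulr0.
  have [->|aj] := eqVneq a j.
    rewrite mulr0 mulr0 add0r (bigD1 i) ?ij'// big1 => [|b].
      by rewrite !eqxx/= addr0 mulr1 mulrC.
    by move=> /andP[_ /negbTE ->]; rewrite mulr0.
  by rewrite big1 ?mulr0 ?addr0// => b _; rewrite mulr0.
- rewrite [trans _ _]/= !mulr0 !add0r -/(inner l).
  rewrite ![inner _ == pos _ _ _ _]eq_sym !pos_eq_inner/= !eqSS.
  case: (a =P i) => [ai|ai]; last first.
    by rewrite [i == a]eq_sym; case: (a =P i) => // _; rewrite !mulr0.
  case: (b =P j) => [bj|bj]; last first.
    by rewrite [j == b]eq_sym; case: (b =P j) => // _; rewrite !andbF !mulr0.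
  subst a b; rewrite !eqxx/= ltnS; congr (_ + _).
    by rewrite eq_sym; case: eqP => [->|_]; rewrite ?mul1r ?mulr0.
  rewrite eq_sym; case: eqP => [kl|_]; last by rewrite !mulr0.
  by rewrite kl -nE ltn_ord mul1r.
- have absorbedE m : (absorbed G a == pos G i j m) = false.
    by case: m => // m; rewrite /pos; case: insub.
  by rewrite /= !absorbedE !mulr0 !addr0.
Qed.
End edge.

(** * From path probabilities to the law at each time *)

Section markov.
Variables (R : realType) (N : nat) (G : barrier_graph R N).
Variables (d : measure_display) (T : measurableType d) (P : probability T R).
Variables (X : nat -> T -> state G) (s0 : state G).
Hypothesis walkX : is_walk_from s0 P X.

Let mX m s : measurable (X m @^-1` [set s]).
Proof. by case: walkX. Qed.

(** The lower bound [a] allows the past to be forgotten one time at a time: a = 0 is the event in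
    [is_walk_from], a = m fixes the present state only. *)
Definition cylinder a m (h : nat -> state G) : set T :=
  [set w | forall l, (a <= l <= m)%N -> X l w = h l].

Lemma measurable_cylinder a m h : measurable (cylinder a m h).
Proof.
rewrite (_ : cylinder a m h =
    \bigcap_(l in [set l | (a <= l <= m)%N]) (X l @^-1` [set h l])).
  by apply: bigcap_measurableType => l _; exact: mX.
by apply/seteqP; split => w /= H l; exact: H.
Qed.

Lemma probability_split m (A : set T) : measurable A ->
  P A = (\sum_(s : state G) P (A `&` X m @^-1` [set s]))%E.
Proof.
move=> mA; rewrite -[in LHS](setIT A) -(_ : \bigcup_(s in setT) (X m @^-1` [set s]) = setT); last first.
  by rewrite -subTset => w _; exists (X m w).
rewrite setI_bigcupr measure_fin_bigcup; [|exact: finite_finset| |]; last first.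
- by move=> s _; apply: measurableI; [|exact: mX].
- by apply/trivIsetP => s t _ _ /eqP st; rewrite -subset0 => w [[_ /= ->] [_ /=]].
rewrite [RHS](fsbig_seq _ _ (index_enum_uniq _)).
rewrite (_ : [set` index_enum _] = setT)//.
by apply/seteqP; split => s //= _; exact: mem_index_enum.
Qed.


(** Summing over the state at time a lifts the constraint there; as a < m in the induction step, the
    transition factor is the same in every summand. *)
Lemma trans_cylinder a m h : (a <= m)%N ->
  P (cylinder a m.+1 h) = (P (cylinder a m h) * (trans (h m) (h m.+1))%:E)%E.
Proof.
elim: a h => [|a IH] h am.
  by case: walkX => _ _ /(_ m h).
pose g s l := if l == a then s else h l.
have cylE m' s : (a < m')%N ->
    cylinder a.+1 m' h `&` X a @^-1` [set s] = cylinder a m' (g s).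
  move=> am'; apply/seteqP; split => w /=.
    move=> [H Xa] l; rewrite /g; case: eqVneq => [->//|la] /andP[al lm].
    by apply: H; rewrite lm andbT ltn_neqAle eq_sym la.
  move=> H; split; last by rewrite H /g ?eqxx// leqnn ltnW.
  by move=> l /andP[al lm]; rewrite H /g ?lm ?(ltnW al)// gtn_eqF.
rewrite (@probability_split a _ (measurable_cylinder _ _ _)).
rewrite (@probability_split a _ (measurable_cylinder a.+1 m h)).
rewrite ge0_sume_distrl; last by move=> s _; exact: measure_ge0.
apply: eq_bigr => s _; rewrite !cylE// ?(ltn_trans am)// IH ?(ltnW am)//.
by rewrite /g !gtn_eqF// ltnS ltnW.
Qed.

Lemma probabilityS m t : P (X m.+1 @^-1` [set t]) =
  (\sum_(s : state G) P (X m @^-1` [set s]) * (trans s t)%:E)%E.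
Proof.
rewrite (@probability_split m _ (mX _ _)); apply: eq_bigr => s _.
pose h l := if l == m then s else t.
have := @trans_cylinder m m h (leqnn _).
rewrite {3 4}/h eqxx gtn_eqF// => e.
rewrite (_ : _ `&` _ = cylinder m m.+1 h).
  rewrite e; congr (P _ * _)%E; apply/seteqP; split => w /=.
    by move=> /(_ m); rewrite leqnn /h eqxx => ->.
  by move=> Xm l; rewrite -eqn_leq => /eqP <-; rewrite /h eqxx.
apply/seteqP; split => w /=.
  move=> [Xm1 Xm] l; rewrite /h; case: eqVneq => [->//|lm] /andP[ml lm1].
  by have -> : l = m.+1 by apply/eqP; rewrite eqn_leq lm1 ltn_neqAle eq_sym lm.
by move=> H; split; rewrite H /h ?eqxx ?leqnSn ?leqnn// gtn_eqF.
Qed.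
End markov.

(** * Expected arrivals on one edge *)

Section edge_arrivals.
Variables (R : realType) (N : nat) (G : barrier_graph R N).
Variables (d : measure_display) (T : measurableType d) (P : probability T R).
Variable X : nat -> T -> state G.
Hypothesis walkX : is_walk_from (barrier G ord0) P X.
Variables i j : 'I_N.+1.
Hypotheses (ltij : (i < j)%N) (joinedij : joined G i j).
Let n := esize G i j.
Let p := fwd G i j.
Let q := bwd G i j.
Let y a := expected_arrivals P X (barrier G a).

(** A positive product gives p and q the same sign, and their sum 1 rules out the negative one. *)
Lemma fwd_gt0_bwd_gt0 : 0 < p /\ 0 < q.
Proof.
have pDq : p + q = 1 by exact: fwd_bwd_sum.
have pq : 0 < p * q by exact: fwd_bwd_gt0.
split; nra.
Qed.

Let p_gt0 : 0 < p. Proof. exact: fwd_gt0_bwd_gt0.1. Qed.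
Let q_gt0 : 0 < q. Proof. exact: fwd_gt0_bwd_gt0.2. Qed.

Let mX m s : measurable (X m @^-1` [set s]).
Proof. by case: walkX. Qed.

Let u m s : R := fine (P (X m @^-1` [set s])).

Let uE m s : P (X m @^-1` [set s]) = (u m s)%:E.
Proof. by rewrite fineK// fin_num_measure. Qed.

Let u_ge0 m s : 0 <= u m s.
Proof. by rewrite fine_ge0. Qed.

(** The start is prescribed only with probability 1, so the event is bounded by the complementary
    null event. *)
Let u0_pos k : (0 < k <= n)%N -> u 0 (pos G i j k) = 0.
Proof.
move=> kn; apply: EFin_inj; rewrite -uE; apply/eqP; rewrite eq_le measure_ge0 andbT.
have [_ P1 _] := walkX.
apply: (@le_trans _ _ (P (~` (X 0%N @^-1` [set barrier G ord0])))); last first.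
  by rewrite probability_setC// P1 subee.
apply: le_measure; rewrite ?inE//; first exact: measurableC.
move=> w /= Xw X0; have := @barrier_eq_pos R N G ord0 i j k.
by rewrite /inner_count ltij joinedij -Xw X0 eqxx => /(_ kn).
Qed.

Let uS m k : (0 < k <= n)%N -> u m.+1 (pos G i j k) =
  (k == 1%N)%:R * (pstar G i j * u m (barrier G i))
  + (1 < k)%N%:R * (p * u m (pos G i j k.-1))
  + ((k == n)%:R * (pstar G j i * u m (barrier G j))
    + (k < n)%N%:R * (q * u m (pos G i j k.+1))).
Proof.
move=> kn; have sumu (s0 : state G) : \sum_s u m s * (s == s0)%:R = u m s0.
  rewrite (bigD1 s0)//= eqxx mulr1 big1 ?addr0// => s /negbTE ->.
  by rewrite mulr0.
rewrite -!sumu !mulr_sumr -!big_split; apply: EFin_inj.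
rewrite -uE (probabilityS walkX) -sumEFin; apply: eq_bigr => s _.
rewrite uE -EFinM trans_pos//; congr _%:E; rewrite -/n -/p -/q /=; ring.
Qed.

(* Dividing by p and q the flows out of the barriers makes position 0 and
   position n + 1 satisfy the same recurrence as the intermediate states. *)
Let W (m k : nat) : R :=
  if k == 0%N then pstar G i j / p * u m (barrier G i)
  else if k == n.+1 then pstar G j i / q * u m (barrier G j)
  else u m (pos G i j k).

Let W_ge0 m k : 0 <= W m k.
Proof.
rewrite /W; case: ifP => _; [|case: ifP => _].
- by apply: mulr_ge0 => //; apply: divr_ge0; [exact: pstar_ge0|exact: ltW].
- by apply: mulr_ge0 => //; apply: divr_ge0; [exact: pstar_ge0|exact: ltW].
- exact: u_ge0.
Qed.

Let W0 k : (k < n)%N -> W 0%N k.+1 = 0.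
Proof.
by move=> kn; rewrite /W/= eqSS ltn_eqF// u0_pos.
Qed.

Let WS m k : (k < n)%N -> W m.+1 k.+1 = p * W m k + q * W m k.+2.
Proof.
move=> kn; rewrite {1}/W/= eqSS ltn_eqF// uS//=; congr (_ + _).
  rewrite /W; case: k kn => [|k] kn /=.
    by rewrite mul1r mul0r addr0; field; rewrite gt_eqF.
  by rewrite mul0r add0r mul1r ltn_eqF// ltnW// ltnW.
rewrite /W /= eqSS; have [->|k1] := eqVneq k.+1 n.
  by rewrite ltnn mul0r mul1r addr0; field; rewrite gt_eqF.
by rewrite mul0r add0r ltn_neqAle k1 kn mul1r.
Qed.

Lemma expected_arrivals_pos k : (0 < k <= n)%N ->
  expected_arrivals P X (pos G i j k) =
  ((1 - ruin p q n k)%:E * ((pstar G i j / p)%:E * y i) +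
   (ruin p q n k)%:E * ((pstar G j i / q)%:E * y j))%E.
Proof.
move=> /andP[k0 kn].
have arrE s : expected_arrivals P X s = (\sum_(0 <= m <oo) (u m s)%:E)%E.
  by apply: eq_eseriesr => m _; rewrite uE.
have pDq : p + q = 1 by exact: fwd_bwd_sum.
have := sum_edge p_gt0 q_gt0 pDq W_ge0 W0 WS (leqW kn).
have -> : (\sum_(0 <= m <oo) (W m k)%:E)%E = expected_arrivals P X (pos G i j k).
  by rewrite arrE; apply: eq_eseriesr => m _; rewrite /W gtn_eqF// ltn_eqF.
move=> ->; rewrite /y !arrE; congr (_ * _ + _ * _)%E;
  rewrite -nneseriesZl; try by move=> m _; rewrite lee_fin.
- by apply: eq_eseriesr => m _; rewrite -EFinM.
- by apply: eq_eseriesr => m _; rewrite /W /= eqxx -EFinM.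
Qed.
End edge_arrivals.

(** * Closed forms of the interpolation *)

(** This introduces the common denominator even for infinite values. [r] may be negative, as 1 -
    rho^(n+1) is for rho > 1; equal signs of [u] and [v] exclude +oo - oo. *)
Lemma muleDK (R : realFieldType) (r : R) (u v : \bar R) : r != 0 ->
  (0 <= u)%E -> (0 <= v)%E -> ((r%:E * u + r%:E * v) / r%:E = u + v)%E.
Proof.
move=> r0 u0 v0; rewrite -ge0_muleDr// muleAC inver (negbTE r0) -EFinM.
by rewrite divff// mul1e.
Qed.

Theorem theorem2 (R : realType) (N : nat) (G : barrier_graph R N)
    (d : measure_display) (T : measurableType d) (P : probability T R)
    (X : nat -> T -> state G)
    (walkX : is_walk_from (barrier G ord0) P X)
    (i j : 'I_N.+1) (ltij : (i < j)%N) (joinedij : joined G i j)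
    (k : nat) (k_gt0 : (1 <= k)%N) (k_le : (k <= esize G i j)%N) :
  let n := esize G i j in
  let p := fwd G i j in
  let q := bwd G i j in
  let rho := p / q in
  let y a := expected_arrivals P X (barrier G a) in
  let x := expected_arrivals P X (pos G i j k) in
  (rho != 1 ->
    x = ((((1 - rho ^+ k) * (pstar G j i / q))%:E * y j
          + ((rho ^+ k - rho ^+ n.+1) * (pstar G i j / p))%:E * y i)
         / (1 - rho ^+ n.+1)%:E)%E) /\
  (rho = 1 ->
    x = (2%:E * ((k%:R * pstar G j i)%:E * y j
                 + ((n.+1%:R - k%:R) * pstar G i j)%:E * y i)
         / (n.+1%:R)%:E)%E).
Proof.
move=> n p q rho y x.
have [p_gt0 q_gt0] := fwd_gt0_bwd_gt0 ltij joinedij.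
have pDq : p + q = 1 by exact: fwd_bwd_sum.
have rn : ruin p q n k < 1 by exact: ruin_lt1.
have r0 : 0 <= ruin p q n k by rewrite -(prednK k_gt0) ltW// ruin_gt0.
have y_ge0 a : (0 <= y a)%E by apply: nneseries_ge0.
have xE : x = ((ruin p q n k)%:E * ((pstar G j i / q)%:E * y j) +
    (1 - ruin p q n k)%:E * ((pstar G i j / p)%:E * y i))%E.
  by rewrite addeC; apply: expected_arrivals_pos; rewrite ?k_gt0.
have yj_ge0 : (0 <= (ruin p q n k)%:E * ((pstar G j i / q)%:E * y j))%E.
  by rewrite !mule_ge0// lee_fin ?divr_ge0 ?pstar_ge0// ltW.
have yi_ge0 : (0 <= (1 - ruin p q n k)%:E * ((pstar G i j / p)%:E * y i))%E.
  by rewrite !mule_ge0// lee_fin ?divr_ge0 ?pstar_ge0// ?subr_ge0 ltW.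
have s0 := geometric_gt0 p_gt0 q_gt0 n.
split=> rho1.
  have geomE m : 1 - rho ^+ m = (1 - rho) * \sum_(l < m) rho ^+ l.
    by rewrite -opprB subrX1 -mulNr opprB.
  have D0 : 1 - rho ^+ n.+1 != 0.
    by rewrite geomE mulf_neq0 ?(lt0r_neq0 s0)// subr_eq0 eq_sym.
  (* The complementary weight then becomes (1 - rho^(n+1)) - (1 - rho^k) = rho^k - rho^(n+1). *)
  have rE : (1 - rho ^+ n.+1) * ruin p q n k = 1 - rho ^+ k.
    rewrite !geomE /ruin -/rho; field; rewrite gt_eqF//.
  rewrite xE -(muleDK D0)// !muleA -!EFinM -rE.
  congr ((_%:E * _ + _%:E * _) / _)%E.
  by congr (_ * _); rewrite mulrBr mulr1 rE; ring.
(* Here p = q = 1/2, so dividing by p or q yields the factor 2, and the ruin probability is k / (n +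
   1). *)
have pq : p = q by rewrite -[p](divfK (lt0r_neq0 q_gt0)) -/rho rho1 mul1r.
have p2 : p = 2^-1 by apply: (mulIf (lt0r_neq0 (ltr0Sn R 1))); rewrite mulVf//; lra.
have geomE m : \sum_(l < m) rho ^+ l = m%:R.
  by under eq_bigr do rewrite rho1 expr1n; rewrite sumr_const card_ord.
have D0 : n.+1%:R != 0 :> R by rewrite pnatr_eq0.
have rE : n.+1%:R * ruin p q n k = k%:R by rewrite /ruin !geomE mulrC divfK.
rewrite xE -(muleDK D0)// ge0_muleDr; last 2 first.
- by rewrite mule_ge0// lee_fin mulr_ge0// pstar_ge0.
- rewrite mule_ge0// lee_fin mulr_ge0 ?pstar_ge0// subr_ge0 ler_nat.
  exact: leqW.
rewrite !muleA -!EFinM -rE -pq p2 invrK.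
by congr ((_%:E * _ + _%:E * _) / _)%E; ring.
Qed.
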